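(* (i) Let $B^{ij}$ be a normal SIMPS tensor with injectivity length $L_1$. Then the MPS tensor $A^i$ obtained from $B^{ij}$ by the SIMPS-to-MPS conversion (defined in the context) is normal with injectivity length $L_0\le L_1+2$. (ii) Let $A^i$ be a normal MPS tensor with injectivity length $L_0$. Then the SIMPS tensor $B^{ij}$ obtained from $A^i$ by the MPS-to-SIMPS conversion (defined in the context) is normal with injectivity length $L_1\le L_0$.
   Context: Fix a physical dimension $d$; physical indices run over $\{0,\dots,d-1\}$. An MPS tensor of bond dimension $D$ is a family of complex $D\times D$ matrices $A^i$. It is normal if there is a positive integer $L$ with $\mathrm{span}\{A^{i_1}A^{i_2}\cdots A^{i_L}\}_{i_1,\dots,i_L}=M_D$, the space of all complex $D\times D$ matrices; the smallest such $L$ is the injectivity length $L_0$. A SIMPS (split-index matrix product state) tensor is a family of complex matrices $B^{ij}$, where $B^{ij}$ is $\chi^i\times\chi^j$ for some integers $\chi^0,\dots,\chi^{d-1}$. It is normal if there is a positive integer $L$ such that for all $s_1,s_2$, $\mathrm{span}\{B^{s_1i_1}B^{i_1i_2}\cdots B^{i_{L-1}i_L}B^{i_Ls_2}\}_{i_1,\dots,i_L}=M_{\chi^{s_1},\chi^{s_2}}$, the space of all complex $\chi^{s_1}\times\chi^{s_2}$ matrices; the smallest such $L$ is the injectivity length $L_1$. SIMPS-to-MPS conversion: given $B^{ij}$, put $\chi=\sum_i\chi^i$ and let $\mathbb{B}=\sum_{i,j,\alpha,\beta}B^{ij}_{\alpha\beta}\,|i\alpha\rangle\langle j\beta|$ be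 the $\chi\times\chi$ block matrix with $(i,j)$ block $B^{ij}$. Let $D=\mathrm{rank}\,\mathbb{B}$ and take a singular value decomposition $\mathbb{B}=u s v^\dagger$, where $u,v$ are $\chi\times D$ matrices with $u^\dagger u=v^\dagger v=\mathbb{1}_D$ and $s$ is a $D\times D$ diagonal matrix with positive entries. Put $w^\dagger=s v^\dagger$, and define the $D\times D$ matrices $A^i=w^\dagger(|i\rangle\langle i|\otimes\mathbb{1})u$, where $|i\rangle\langle i|\otimes\mathbb{1}$ denotes the orthogonal projector onto the $i$-th block $\mathbb{C}^{\chi^i}$ of $\mathbb{C}^\chi=\bigoplus_i\mathbb{C}^{\chi^i}$. MPS-to-SIMPS conversion: given $A^i$, let $\chi^i=\mathrm{rank}\,A^i$ and let $P^i:\mathbb{C}^{\chi^i}\to\mathbb{C}^D$ be an isometry ($P^{i\dagger}P^i=\mathbb{1}_{\chi^i}$) such that $P^iP^{i\dagger}$ is the orthogonal projector onto $(\ker A^i)^\perp$, so that $A^i=A^iP^iP^{i\dagger}$. Define $B^{ij}=P^{i\dagger}A^jP^j$, a $\chi^i\times\chi^j$ matrix. *)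

(* Defs.v *)
From mathcomp Require Export all_boot all_order all_algebra.
From mathcomp Require Export reals complex.

Set Implicit Arguments.
Unset Strict Implicit.
Unset Printing Implicit Defensive.

Import Order.TTheory GRing.Theory Num.Theory.

Local Open Scope ring_scope.
Local Open Scope sesquilinear_scope.

(* [M ^t*] is the conjugate transpose of M.  Matrices act on column vectors.
   Bond dimensions, block sizes and d are arbitrary naturals, 0 included: a
   block size \rank (A i) vanishes as soon as A i = 0. *)

Definition is_least_pos (P : nat -> Prop) (L : nat) : Prop :=
  [/\ (0 < L)%N, P L & forall L' : nat, (0 < L')%N -> P L' -> (L <= L')%N].

Section MPS.
Variables (C : numClosedFieldType) (d D : nat) (A : 'I_d -> 'M[C]_D).

Definition mps_spans (L : nat) : Prop :=
  <<[seq \prod_(i <- w) A i | w : L.-tuple 'I_d]>>%VS = fullv.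

Definition mps_normal : Prop := exists2 L : nat, (0 < L)%N & mps_spans L.

Definition mps_injectivity_length (L : nat) : Prop := is_least_pos mps_spans L.

End MPS.

Section SIMPS.
Variables (C : numClosedFieldType) (d : nat) (chi : 'I_d -> nat).
Variable B : forall i j : 'I_d, 'M[C]_(chi i, chi j).

(* B^{s1 i1} B^{i1 i2} ... B^{iL s2} for w = [:: i1; ...; iL]: L + 1 factors. *)
Fixpoint simps_prod (s1 : 'I_d) (w : seq 'I_d) (s2 : 'I_d) :
    'M[C]_(chi s1, chi s2) :=
  if w is i :: w' then B s1 i *m simps_prod i w' s2 else B s1 s2.

Definition simps_spans (L : nat) : Prop :=
  forall s1 s2 : 'I_d,
    <<[seq simps_prod s1 w s2 | w : L.-tuple 'I_d]>>%VS = fullv.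

Definition simps_normal : Prop := exists2 L : nat, (0 < L)%N & simps_spans L.

Definition simps_injectivity_length (L : nat) : Prop :=
  is_least_pos simps_spans L.

Definition simps_mx : 'M[C]_(\sum_i chi i) := \mxblock_(i, j) B i j.

End SIMPS.

(* The orthogonal projector |i><i| (x) 1 onto the i-th block. *)
Definition block_proj (C : numClosedFieldType) (d : nat) (chi : 'I_d -> nat)
    (i : 'I_d) : 'M[C]_(\sum_j chi j) :=
  \mxdiag_j (if j == i then 1%:M else 0 : 'M[C]_(chi j)).

(* The diagonal of s is stored as a row vector. *)
Definition compact_svd (C : numClosedFieldType) (m n : nat) (M : 'M[C]_(m, n))
    (u : 'M[C]_(m, \rank M)) (s : 'rV[C]_(\rank M)) (v : 'M[C]_(n, \rank M)) :
    Prop :=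
  [/\ u^t* *m u = 1%:M, v^t* *m v = 1%:M, forall k, 0 < s 0 k
    & M = u *m diag_mx s *m v^t*].

Definition simps_to_mps (C : numClosedFieldType) (d : nat) (chi : 'I_d -> nat)
    (D : nat) (u : 'M[C]_(\sum_j chi j, D)) (s : 'rV[C]_D)
    (v : 'M[C]_(\sum_j chi j, D)) (i : 'I_d) : 'M[C]_D :=
  diag_mx s *m v^t* *m block_proj C chi i *m u.

Definition ker_ortho (C : numClosedFieldType) (m n : nat) (M : 'M[C]_(m, n))
    (y : 'cV[C]_n) : Prop :=
  forall x : 'cV[C]_n, M *m x = 0 -> x^t* *m y = 0.

Definition orthogonal_projector (C : numClosedFieldType) (n : nat)
    (Q : 'M[C]_n) (W : 'cV[C]_n -> Prop) : Prop :=
  [/\ Q *m Q = Q, Q^t* = Q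
    & forall y : 'cV[C]_n, W y <-> exists x : 'cV[C]_n, y = Q *m x].

Definition support_isometries (C : numClosedFieldType) (d D : nat)
    (A : 'I_d -> 'M[C]_D) (P : forall i : 'I_d, 'M[C]_(D, \rank (A i))) : Prop :=
  forall i : 'I_d,
    (P i)^t* *m P i = 1%:M
    /\ orthogonal_projector (P i *m (P i)^t*) (ker_ortho (A i)).

Definition mps_to_simps (C : numClosedFieldType) (d D : nat)
    (A : 'I_d -> 'M[C]_D) (P : forall i : 'I_d, 'M[C]_(D, \rank (A i)))
    (i j : 'I_d) : 'M[C]_(\rank (A i), \rank (A j)) :=
  (P i)^t* *m A j *m P j.

Arguments compact_svd {C m n} M u s v.
Arguments support_isometries {C d D} A P.
Arguments mps_to_simps {C d D} A P i j.

(* Main.v *)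
Require Import Defs.

Set Implicit Arguments.
Unset Strict Implicit.
Unset Printing Implicit Defensive.

Import Order.TTheory GRing.Theory Num.Theory.

(** (i) Write [J_i] and [K_i = J_i^T] for the inclusion of and the restriction
    to the i-th block.  Since [u w^dagger] is the block matrix of [B], a product
    of [A]'s over the word [s1, w, s2] is
    [w^dagger J_s1 (simps_prod s1 w s2) K_s2 u].  The middle factor is arbitrary
    by normality, every [X] is the sum of its blocks [J_s1 (K_s1 X J_s2) K_s2],
    and [X |-> w^dagger X u] is onto because [w^dagger] has a right inverse and
    [u] a left inverse.

    (ii) As [A^i P^i P^i^dagger = A^i], the interior projectors disappear and
    [simps_prod s1 w s2 = P^s1^dagger (A^i1 ... A^iL) (A^s2 P^s2)].  Here
    [P^s1^dagger] has a right inverse, and [A^s2 P^s2] has a left inverse since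
    its rank is that of [A^s2], the number of its columns. *)

Local Open Scope ring_scope.
Local Open Scope sesquilinear_scope.

(** The boolean reflection [p] makes [P] decidable, so [ex_minn] yields the least positive witness
    without a classical axiom. *)
Lemma is_least_pos_exists (P : nat -> Prop) (p : pred nat) (L : nat) :
  (forall n, reflect (P n) (p n)) -> (0 < L)%N -> P L ->
  exists2 L0, is_least_pos P L0 & (L0 <= L)%N.
Proof.
move=> pP L_gt0 PL.
have exL : exists n, (0 < n)%N && p n by exists L; rewrite L_gt0; apply/pP.
case: (ex_minnP exL) => L0 /andP[L0_gt0 /pP PL0] L0_min.
have min n : (0 < n)%N -> P n -> (L0 <= n)%N.
  by move=> n_gt0 /pP Pn; rewrite L0_min ?n_gt0.
by exists L0; [split | apply: min].
Qed.

(** A linear map sends a span to the span of the images. With [W] a span of products over words,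
    this reduces spanning to a check on generators. *)
Lemma linear_span_full (K : fieldType) (U V : vectType K) (f : {linear U -> V})
    (X : seq U) (W : {vspace V}) :
  <<X>>%VS = fullv -> (forall x, x \in X -> f x \in W) -> forall x, f x \in W.
Proof.
move=> spanX XW x; rewrite -(lfunE f).
have : (linfun f @: <<X>> <= W)%VS.
  by rewrite limg_span; apply/span_subvP => _ /mapP[y /XW + ->]; rewrite lfunE.
by rewrite spanX => /subvP; apply; rewrite memv_img ?memvf.
Qed.

Section MPSLeast.
Variables (C : numClosedFieldType) (d D : nat) (A : 'I_d -> 'M[C]_D).

Lemma mps_injectivity_length_exists (L : nat) :
  (0 < L)%N -> mps_spans A L ->
  mps_normal A /\
  exists2 L0, mps_injectivity_length A L0 & (L0 <= L)%N.
Proof.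
move=> L_gt0 AL; split; first by exists L.
pose p n := <<[seq \prod_(i <- w) A i | w : n.-tuple 'I_d]>>%VS == fullv.
by apply: (is_least_pos_exists (p := p)) L_gt0 AL => n; apply: eqP.
Qed.

End MPSLeast.

Section SIMPSLeast.
Variables (C : numClosedFieldType) (d : nat) (chi : 'I_d -> nat).
Variable B : forall i j : 'I_d, 'M[C]_(chi i, chi j).

Lemma simps_injectivity_length_exists (L : nat) :
  (0 < L)%N -> simps_spans B L ->
  simps_normal B /\
  exists2 L1, simps_injectivity_length B L1 & (L1 <= L)%N.
Proof.
move=> L_gt0 BL; split; first by exists L.
(* The boundary indices range over a finite type, so the quantified condition is still a boolean. *)
pose p n := [forall s1, forall s2,
  <<[seq simps_prod B s1 w s2 | w : n.-tuple 'I_d]>>%VS == fullv].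
apply: (is_least_pos_exists (p := p)) L_gt0 BL => n.
apply: (iffP forallP) => [pn s1 s2 | Bn s1].
  by apply/eqP; have /forallP := pn s1; apply.
by apply/forallP => s2; apply/eqP/Bn.
Qed.

End SIMPSLeast.

Section Blocks.
Variables (C : numClosedFieldType) (d : nat) (chi : 'I_d -> nat).

Definition block_incl (i : 'I_d) : 'M[C]_(\sum_j chi j, chi i) :=
  submxrow 1%:M i.
Definition block_restr (i : 'I_d) : 'M[C]_(chi i, \sum_j chi j) :=
  submxcol 1%:M i.

Lemma block_projE i : block_proj C chi i = block_incl i *m block_restr i.
Proof.
rewrite /block_incl /block_restr -mxdiagZ /mxdiag.
rewrite submxrow_matrix submxcol_matrix mul_mxcol_mxrow.
(* Both [(j, k)] blocks vanish unless [j = i = k]; [conform_mx] is the cast that [mxdiag] needs for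
   dependent block sizes. *)
apply: eq_mxblock => j k; case: (eqVneq j i) => [->|nji].
  by case: (eqVneq i k) => [<-|_]; rewrite ?conform_mx_id ?mulmx1 ?mulmx0.
by rewrite mul0mx; case: (eqVneq j k) => // <-; rewrite conform_mx_id.
Qed.

Lemma sum_block_proj : \sum_i block_proj C chi i = 1%:M.
Proof.
rewrite (eq_bigr _ (fun i _ => block_projE i)).
by rewrite -mul_mxrow_mxcol /block_incl /block_restr submxrowK submxcolK mulmx1.
Qed.

Lemma block_simps_mx (B : forall i j : 'I_d, 'M[C]_(chi i, chi j)) i j :
  block_restr i *m simps_mx B *m block_incl j = B i j.
Proof.
by rewrite submxcol_mul mul1mx mul_submxrow mulmx1 -submxblockEv mxblockK.
Qed.

End Blocks.

Section SimpsToMps.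
Variables (C : numClosedFieldType) (d : nat) (chi : 'I_d -> nat).
Variable B : forall i j : 'I_d, 'M[C]_(chi i, chi j).
Variables (u v : 'M[C]_(\sum_i chi i, \rank (simps_mx B))).
Variable s : 'rV[C]_(\rank (simps_mx B)).
Hypothesis svdB : compact_svd (simps_mx B) u s v.

Let wt : 'M_(_, _) := diag_mx s *m v^t*.

(** This is the factor created where two consecutive matrices of the converted tensor meet in a
    product. *)
Let block_svd i j :
  B i j = block_restr C chi i *m u *m (wt *m block_incl C chi j).
Proof.
case: svdB => _ _ _ BE.
by rewrite -block_simps_mx [X in _ *m X *m _]BE /wt !mulmxA.
Qed.

Lemma simps_to_mpsE i :
  simps_to_mps u s v i = wt *m block_incl C chi i *m (block_restr C chi i *m u).
Proof. by rewrite /simps_to_mps block_projE !mulmxA. Qed.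

(** The outer letters [s1] and [s2] fix the boundary indices of the SIMPS product; they account for
    the [+ 2] in the bound. *)
Lemma prod_simps_to_mps s1 w s2 :
  \prod_(i <- s1 :: rcons w s2) simps_to_mps u s v i =
  wt *m block_incl C chi s1 *m simps_prod B s1 w s2 *m (block_restr C chi s2 *m u).
Proof.
elim: w s1 => [|i w IHw] s1 /=; rewrite big_cons -[_ * _]/(_ *m _).
  by rewrite big_seq1 !simps_to_mpsE block_svd !mulmxA.
by rewrite IHw !simps_to_mpsE block_svd !mulmxA.
Qed.

Lemma simps_to_mps_sandwich (Y : 'M[C]_(\rank (simps_mx B))) :
  exists X, Y = wt *m X *m u.
Proof.
case: svdB => uu vv s_gt0 _.
have ss : diag_mx s *m diag_mx (\row_k (s 0 k)^-1) = 1%:M.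
  rewrite mulmx_diag -diag_const_mx; congr diag_mx.
  by apply/rowP => k; rewrite !mxE divff // gt_eqF.
(* [v] times the inverse of [diag_mx s] is a right inverse of [wt], and [u^t*] is a left inverse of
   [u]. *)
exists (v *m diag_mx (\row_k (s 0 k)^-1) *m Y *m u^t*).
rewrite -[RHS]mulmxA -[_ *m u^t* *m u]mulmxA uu mulmx1 !mulmxA.
by rewrite /wt -[_ *m v^t* *m v]mulmxA vv mulmx1 ss mul1mx.
Qed.

Lemma simps_to_mps_spans L :
  simps_spans B L -> mps_spans (simps_to_mps u s v) (L + 2).
Proof.
move=> BL; apply/vspaceP => Y; rewrite memvf.
have [X ->] := simps_to_mps_sandwich Y.
(* Resolving the identity on both sides of [X] cuts it into blocks, treated one pair [(s1, s2)] at a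
   time. *)
rewrite -[X in wt *m X]mul1mx -[1%:M *m X]mulmx1 -sum_block_proj.
rewrite !(mulmx_suml, mulmx_sumr); apply: memv_suml => s2 _.
rewrite !(mulmx_suml, mulmx_sumr); apply: memv_suml => s1 _.
rewrite !block_projE.
pose f : {linear _ -> _} := mulmxr (block_restr C chi s2 *m u)
  \o mulmx (wt *m block_incl C chi s1).
rewrite (_ : _ *m _ = f (block_restr C chi s1 *m X *m block_incl C chi s2));
  last by rewrite /= !mulmxA.
apply: (linear_span_full (BL s1 s2)) => _ /mapP[w _ ->]; apply: memv_span.
have szw : size (s1 :: rcons w s2) == (L + 2)%N.
  by rewrite /= size_rcons size_tuple addn2.
apply/mapP; exists (Tuple szw); first by rewrite mem_enum.
by rewrite /= -prod_simps_to_mps.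
Qed.

End SimpsToMps.

Section MpsToSimps.
Variables (C : numClosedFieldType) (d D : nat) (A : 'I_d -> 'M[C]_D).
Variable P : forall i : 'I_d, 'M[C]_(D, \rank (A i)).
Hypothesis isoP : support_isometries A P.

(** The range of the adjoint of [A i] is orthogonal to the kernel of [A i], hence fixed by the
    projector; taking adjoints gives the claim. *)
Lemma support_isometriesK i : A i *m (P i *m (P i)^t*) = A i.
Proof.
have [_ [QQ Qadj imQ]] := isoP i; set Q := P i *m _ in QQ Qadj imQ *.
have QA : Q *m (A i)^t* = (A i)^t*.
  have Qfix (y : 'cV_D) : Q *m ((A i)^t* *m y) = (A i)^t* *m y.
    have /imQ[x ->] : ker_ortho (A i) ((A i)^t* *m y).
      move=> z Az0; rewrite mulmxA -map_mxM -trmx_mul Az0 trmx0 map_mx0.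
      by rewrite mul0mx.
    by rewrite mulmxA QQ.
  apply/matrixP => k l; have /colP/(_ k) := Qfix (delta_mx l 0).
  by rewrite mulmxA -!colE !mxE.
by rewrite -[LHS]trmxCK trmx_mul map_mxM Qadj QA trmxCK.
Qed.

(** Keeping [A s2] with [P s2] as a boundary factor leaves exactly the word [w] in the middle, so
    the length does not change. *)
Lemma mps_to_simps_prod s1 w s2 :
  simps_prod (mps_to_simps A P) s1 w s2 =
  (P s1)^t* *m (\prod_(i <- w) A i) *m (A s2 *m P s2).
Proof.
elim: w s1 => [|i w IHw] s1 /=.
  by rewrite big_nil mulmx1 mulmxA.
rewrite IHw big_cons -[_ * _]/(_ *m _) /mps_to_simps !mulmxA; congr (_ *m _ *m _ *m _).
by rewrite -!mulmxA support_isometriesK.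
Qed.

Lemma mps_to_simps_spans L :
  mps_spans A L -> simps_spans (mps_to_simps A P) L.
Proof.
move=> AL s1 s2; apply/vspaceP => Y; rewrite memvf.
(* Factoring [A s2] through [A s2 *m P s2] bounds the rank of the latter below by [\rank (A s2)],
   its number of columns. *)
have /row_fullP[G GAP] : row_full (A s2 *m P s2).
  rewrite /row_full eqn_leq rank_leq_col -{1}(support_isometriesK s2) mulmxA.
  by rewrite mxrankM_maxl.
have [PP _] := isoP s1.
pose f : {linear _ -> _} := mulmxr (A s2 *m P s2) \o mulmx ((P s1)^t*).
have -> : Y = f (P s1 *m Y *m G).
  by rewrite /= -!mulmxA GAP mulmx1 mulmxA PP mul1mx.
apply: (linear_span_full AL) => _ /mapP[w _ ->]; apply: memv_span.
apply/mapP; exists w; first by rewrite mem_enum.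
by rewrite mps_to_simps_prod.
Qed.

End MpsToSimps.

Theorem proposition1 (R : realType) (d : nat) :
  (forall (chi : 'I_d -> nat) (B : forall i j : 'I_d, 'M[R[i]]_(chi i, chi j))
          (L1 : nat)
          (u : 'M[R[i]]_(\sum_i chi i, \rank (simps_mx B)))
          (s : 'rV[R[i]]_(\rank (simps_mx B)))
          (v : 'M[R[i]]_(\sum_i chi i, \rank (simps_mx B))),
      simps_normal B -> simps_injectivity_length B L1 ->
      compact_svd (simps_mx B) u s v ->
      mps_normal (simps_to_mps u s v) /\
      exists2 L0 : nat,
        mps_injectivity_length (simps_to_mps u s v) L0 & (L0 <= L1 + 2)%N)
  /\
  (forall (D : nat) (A : 'I_d -> 'M[R[i]]_D) (L0 : nat)
          (P : forall i : 'I_d, 'M[R[i]]_(D, \rank (A i))),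
      mps_normal A -> mps_injectivity_length A L0 ->
      support_isometries A P ->
      simps_normal (mps_to_simps A P) /\
      exists2 L1 : nat,
        simps_injectivity_length (mps_to_simps A P) L1 & (L1 <= L0)%N).
Proof.
split=> [chi B L1 u s v _ [L1_gt0 BL1 _] svdB | D A L0 P _ [L0_gt0 AL0 _] isoP].
  apply: mps_injectivity_length_exists; first by rewrite addn2.
  exact: simps_to_mps_spans.
exact/simps_injectivity_length_exists/mps_to_simps_spans.
Qed.
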